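(* Let $G$ be a finitely generated group. If $G$ has infinite girth, then $G_{bound}$ does not contain non-trivial torsion elements (i.e. non-identity elements of finite order).
   Context: For a finitely generated group $G$, a finite generating set $S$ of $G$ and $g\in G$, the word-length $l_S(g)$ is the minimal integer $n\ge 0$ such that $g$ is a product of $n$ elements of $S\cup S^{-1}$. $G_{bound}$ denotes the set of all $g\in G$ for which there exists a constant $M>0$ such that $l_S(g)<M$ for every finite generating set $S$ of $G$; it is a subgroup of $G$. Let $\Gamma(G,S)$ be the Cayley graph of $G$ with respect to $S$, with one edge labelled $s$ from $h$ to $hs$ for each $h\in G$, $s\in S$ (so a generator $s$ with $s^2=e$ gives two edges between $h$ and $hs$, and the word $ss$ describes a simple loop of length 2). A simple loop in $\Gamma(G,S)$ is a non-trivial path (edges may be traversed in either direction; a path immediately backtracking along the same edge does not count) starting and ending at the identity $e$ without self-intersections. The girth of $\Gamma(G,S)$ is the minimal length of a simple loop in it. The group $G$ has infinite girth if for every constant $k>0$ there is a finite generating set $S$ of $G$ such that the girth of $\Gamma(G,S)$ is greater than $k$. *)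

(* Defs.v *)
From HB Require Import structures.
From mathcomp Require Import all_boot finmap.
From mathcomp Require Import boolp classical_sets.

Set Implicit Arguments.
Unset Strict Implicit.
Unset Printing Implicit Defensive.

Local Open Scope group_scope.
Local Open Scope fset_scope.

(* [None] stands for +oo, the minimum of an empty set of naturals. *)
Definition least (P : nat -> Prop) : option nat :=
  match pselect (exists n, `[< P n >]) with
  | left exP => Some (ex_minn exP)
  | right _ => None
  end.

Section GroupGirth.
Variable G : groupType.
Implicit Types (S : {fset G}) (g h : G) (n : nat).

Definition symmetrized S : {fset G} := S `|` [fset x^-1 | x in S].

Definition product_of S g n : Prop :=
  exists w : seq G,
    [/\ size w = n, {subset w <= symmetrized S} & \prod_(x <- w) x = g].

Definition generates S : Prop := forall g, exists n, product_of S g n.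

(* The default 0 is never reached when S generates G. *)
Definition word_length S g : nat := odflt 0 (least (product_of S g)).

Definition Gbound : set G :=
  [set g | exists2 M, 0 < M &
    forall S, generates S -> word_length S g < M]%N%classic.

Definition torsion : set G :=
  [set g | exists2 n, (0 < n)%N & g ^+ n = 1]%classic.

(* The Cayley graph as a multigraph: [(h, s)] is the edge labelled s from h to
   h * s. A dart is an edge with a direction of traversal, [true] meaning from
   h * s to h. *)
Definition dart : Type := ((G * G) * bool)%type.
Definition label (d : dart) : G := d.1.2.
Definition source (d : dart) : G := if d.2 then d.1.1 * d.1.2 else d.1.1.
Definition target (d : dart) : G := if d.2 then d.1.1 else d.1.1 * d.1.2.
Definition reverse (d : dart) : dart := (d.1, ~~ d.2).

Fixpoint cayley_path S g h (p : seq dart) : bool :=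
  if p is d :: p' then
    [&& label d \in S, source d == g & cayley_path S (target d) h p']
  else g == h.

Definition nonbacktracking (p : seq dart) : bool :=
  sorted [rel d d' : dart | d' != reverse d] p.

(* [map source p] lists the vertices of a closed path, its endpoint counted
   once. *)
Definition simple_loop S (p : seq dart) : bool :=
  [&& p != [::], cayley_path S 1 1 p, nonbacktracking p
    & uniq (map source p)].

Definition girth S : option nat :=
  least (fun n => exists2 p, simple_loop S p & size p = n).

End GroupGirth.

Arguments Gbound : clear implicits.
Arguments torsion : clear implicits.

Definition finitely_generated (G : groupType) : Prop :=
  exists S : {fset G}, generates S.

Definition girth_gt (G : groupType) (S : {fset G}) (k : nat) : bool :=
  if girth S is Some n then (k < n)%N else true.

Definition infinite_girth (G : groupType) : Prop :=
  forall k : nat, (0 < k)%N ->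
    exists2 S : {fset G}, generates S & girth_gt S k.

(* Main.v *)
Require Import Defs.
From mathcomp Require Import all_boot finmap.
From mathcomp Require Import boolp classical_sets.

(** Fix g <> 1 with g ^+ n = 1, and suppose that g has length less than M with
    respect to every finite generating set.  Choose S of girth greater than
    n * M, and let w be a word in the letters s, s^-1 (s in S), shortest among
    the words that represent a conjugate of g.  Then |w| < M, w is not empty
    since g <> 1, and w is cyclically reduced: a cancelling pair of cyclically
    consecutive letters of w could be deleted, giving a shorter representative
    of a conjugate of g ([minimal_cyclically_reduced]).  So the power w ^ n is
    a nonempty reduced word of length less than n * M, and it represents a
    conjugate of g ^+ n = 1.

    A nonempty reduced word representing 1 traces a closed path without
    backtracking in the Cayley graph.  A shortest nonempty closed subpath has
    no self-intersection, hence is a simple loop up to translation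
    ([reduced_relation_loop]).  This contradicts the choice of S.

    Letters are kept formal: s and s^-1 are distinct letters even when s is an
    involution, just as the two directions of an edge are distinct darts.  The
    word s s is then reduced, in agreement with the loop of length 2 that it
    describes. *)

Set Implicit Arguments.
Unset Strict Implicit.
Unset Printing Implicit Defensive.

Local Open Scope group_scope.

(** * Minima of sets of naturals *)

Lemma least_le (P : nat -> Prop) n :
  P n -> exists m, [/\ least P = Some m, P m & m <= n].
Proof.
move=> Pn; rewrite /least; case: pselect => [exP|[]]; last first.
  by exists n; apply/asboolP.
case: ex_minnP => m /asboolP Pm min_m.
by exists m; split=> //; apply/min_m/asboolP.
Qed.

(** * Sequences *)

Section Sequences.
Variables (T : Type) (e : rel T).

Lemma not_sorted_split s : ~~ sorted e s ->
  exists u a b v, s = u ++ [:: a, b & v] /\ ~~ e a b.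
Proof.
elim: s => [//|a [//|b s] IHs] /=; rewrite negb_and => /orP[nab|/IHs].
  by exists [::], a, b, s.
by move=> [u [c [d [v [-> ncd]]]]]; exists (a :: u), c, d, v.
Qed.

(** The closing condition of the cycle is what the junction between two
    consecutive copies of s requires. *)
Lemma sorted_flatten_nseq n s : cycle e s -> sorted e (flatten (nseq n s)).
Proof.
case: s => [|x s]; first by elim: n.
rewrite /cycle rcons_path => /andP[xs sx].
have ps m : path e (last x s) (flatten (nseq m (x :: s))).
  by elim: m => //= m IHm; rewrite sx cat_path xs IHm.
by move/path_sorted: (ps n).
Qed.

End Sequences.

Section Words.
Variable G : groupType.
Implicit Types (S : {fset G}) (g h : G) (w : seq (G * bool)).

(** * Words in formal letters *)

(** The letter [(s, true)] is the formal inverse of [(s, false)]; the boolean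
    has the same meaning as in a dart. *)
Definition letter_value (x : G * bool) : G := if x.2 then x.1^-1 else x.1.
Definition word_value w : G := \prod_(x <- w) letter_value x.
Definition word_in S w : bool := all (fun x => x.1 \in S) w.
Definition not_cancelling : rel (G * bool) :=
  [rel x y | y != (x.1, ~~ x.2)].

Lemma word_in_cat S w1 w2 :
  word_in S (w1 ++ w2) = word_in S w1 && word_in S w2.
Proof. exact: all_cat. Qed.

Lemma word_value_cat w1 w2 :
  word_value (w1 ++ w2) = word_value w1 * word_value w2.
Proof. exact: big_cat. Qed.

Lemma word_value_cons x w :
  word_value (x :: w) = letter_value x * word_value w.
Proof. exact: big_cons. Qed.

Lemma word_value_power n w :
  word_value (flatten (nseq n w)) = word_value w ^+ n.
Proof.
elim: n => [|n IHn] /=; first by rewrite /word_value big_nil.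
by rewrite word_value_cat IHn expgS.
Qed.

Lemma word_in_power S n w : word_in S w -> word_in S (flatten (nseq n w)).
Proof. by move=> wS; elim: n => //= n IHn; rewrite word_in_cat wS. Qed.

Lemma cancelling_value a b :
  ~~ not_cancelling a b -> letter_value b = (letter_value a)^-1.
Proof.
by rewrite /= negbK => /eqP->; rewrite /letter_value; case: a.2; rewrite ?invgK.
Qed.

Lemma not_cancelling_refl : reflexive not_cancelling.
Proof. by case=> s [] /=; apply/eqP. Qed.

Lemma product_of_word S g n : product_of S g n ->
  exists w, [/\ size w = n, word_in S w & word_value w = g].
Proof.
case=> v [<- vS <-]; elim: v vS => [|x v IHv] vS.
  by exists [::]; split=> //; rewrite /word_value !big_nil.
have [y yv|w [sw wS wv]] := IHv; first by apply: vS; rewrite inE yv orbT.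
have [a aS ax] : exists2 a : G * bool, a.1 \in S & letter_value a = x.
  have /vS : x \in x :: v by rewrite inE eqxx.
  rewrite in_fsetU => /orP[xS|/imfsetP[s sS ->]]; first by exists (x, false).
  by exists (s, true).
by exists (a :: w); rewrite /= aS wS sw word_value_cons wv ax big_cons.
Qed.

Definition represents_conjugate S g w : Prop :=
  word_in S w /\ exists h, word_value w = g ^ h.

(** Deleting an inner cancelling pair preserves the value of the word, and
    deleting its first and last letters, if these cancel, conjugates it. *)
Lemma minimal_cyclically_reduced S g w :
    represents_conjugate S g w ->
    (forall v, represents_conjugate S g v -> size w <= size v) ->
  cycle not_cancelling w.
Proof.
move=> [wS [h wg]] min_w; apply: contraT.
case: w wS wg min_w => [//|x w] wS wg min_w.
(* The cyclic condition on x :: w is the linear one on x :: rcons w x. *)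
case/(@not_sorted_split _ _ (x :: rcons w x)) => [u [a [b [v [def_w nab]]]]].
have ab := cancelling_value nab.
case/lastP: v => [|v y] in def_w.
  (* The bad pair is the last letter of the word followed by its first one. *)
  move: def_w; rewrite -rcons_cons -cat_rcons cats1 => /rcons_inj[].
  case: u => [|z u] /= [xz def_w] xb.
    (* In a one-letter word it would be a letter formally inverse to itself. *)
    by case/negP: nab; rewrite -xz -xb not_cancelling_refl.
  rewrite {}def_w {}xb {xz} in wS wg min_w.
  have /min_w : represents_conjugate S g u.
    move: wS; rewrite /= /word_in all_rcons => /and3P[_ _ uS].
    split=> //; exists (h * letter_value b); rewrite conjgM -wg.
    rewrite word_value_cons -cats1 word_value_cat [word_value [:: a]]big_seq1.
    rewrite conjgE -!mulgA mulKg.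
    by rewrite ab mulgV mulg1.
  by rewrite /= size_rcons ltnNge leqW.
move: def_w; rewrite -rcons_cons -[u ++ _]/(u ++ [:: a, b & rcons v y]).
rewrite -!rcons_cons -rcons_cat => /rcons_inj[def_w _].
rewrite {}def_w in wS wg min_w.
have /min_w : represents_conjugate S g (u ++ v).
  split; first by move: wS; rewrite !word_in_cat => /and4P[-> _ _].
  exists h; rewrite -wg !word_value_cat !word_value_cons ab.
  by rewrite [letter_value a * _]mulgA mulgV mul1g.
by rewrite !size_cat /= !addnS ltnNge leqW.
Qed.

(** * Paths in the Cayley graph *)

(** An inverse letter s^-1 read at g follows backwards the edge labelled s that
    ends at g, hence is based at g * s^-1. *)
Fixpoint word_path g w : seq (dart G) :=
  if w is x :: w' then
    ((if x.2 then g * x.1^-1 else g, x.1), x.2)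
      :: word_path (g * letter_value x) w'
  else [::].

Lemma size_word_path g w : size (word_path g w) = size w.
Proof. by elim: w g => //= x w IHw g; rewrite IHw. Qed.

Lemma word_path_cayley S g w :
  word_in S w -> cayley_path S g (g * word_value w) (word_path g w).
Proof.
elim: w g => [|x w IHw] g /=; first by rewrite /word_value big_nil mulg1.
case/andP=> xS wS; rewrite xS word_value_cons mulgA /source /target /=.
have := IHw (g * letter_value x) wS.
by rewrite /letter_value; case: x.2; rewrite /= ?mulgVK eqxx.
Qed.

Lemma word_path_nonbacktracking g w :
  sorted not_cancelling w -> nonbacktracking (word_path g w).
Proof.
rewrite /nonbacktracking; elim: w g => [//|x [//|y w] IHw] g /=.
case/andP=> xy yw; apply/andP; split; last exact: (IHw (g * letter_value x)).
by apply: contra xy => /eqP[_ <- <-]; rewrite -surjective_pairing.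
Qed.

Lemma nth_source_word_path g w i : i < size w ->
  nth 1 (map (@source G) (word_path g w)) i = g * word_value (take i w).
Proof.
elim: w g i => [//|x w IHw] g [|i] /= ltiw.
  rewrite /word_value big_nil mulg1 /source /=.
  by case: x.2; rewrite //= mulgVK.
by rewrite IHw // word_value_cons mulgA.
Qed.

(** If the path of w from 1 meets a vertex twice, the factor of w read between
    the two visits is a shorter nonempty reduced word of value 1. *)
Lemma reduced_relation_loop S w :
    word_in S w -> sorted not_cancelling w -> w != [::] ->
    word_value w = 1 ->
  exists2 p, simple_loop S p & size p <= size w.
Proof.
have [n] := ubnP (size w); elim: n w => // n IHn w /ltnSE lewn wS wred w0 w1.
have [up|] := boolP (uniq (map (@source G) (word_path 1 w))).
  exists (word_path 1 w); last by rewrite size_word_path.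
  rewrite /simple_loop up word_path_nonbacktracking // !andbT.
  have := word_path_cayley 1 wS; rewrite w1 mulg1 => ->.
  by rewrite andbT -size_eq0 size_word_path size_eq0.
move/(uniqPn 1) => [i [j [ltij]]]; rewrite size_map size_word_path => ltjw.
rewrite !nth_source_word_path ?(ltn_trans ltij) // !mul1g => eq_ij.
pose v := drop i (take j w).
have szv : size v = j - i by rewrite size_drop size_takel // ltnW.
have ltvw : size v < size w by rewrite szv (leq_ltn_trans (leq_subr i j)).
have [||||| p ploop lep] := IHn v.
- exact: leq_trans ltvw lewn.
- by apply/allP=> x /mem_drop/mem_take; apply: (allP wS).
- exact/drop_sorted/take_sorted.
- by rewrite -size_eq0 szv subn_eq0 -ltnNge.
- have : word_value (take i w) * word_value v = word_value (take i w) * 1.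
    rewrite mulg1 {2}eq_ij -word_value_cat.
    by rewrite -[take j w](cat_take_drop i) take_takel // ltnW.
  exact: mulgI.
by exists p => //; apply: leq_trans lep (ltnW ltvw).
Qed.

Lemma girth_gt_loop S k p : girth_gt S k -> simple_loop S p -> k < size p.
Proof.
move=> gtk ploop.
have [|m [Em _ lem]] :=
  @least_le (fun n => exists2 p, simple_loop S p & size p = n) (size p).
  by exists p.
by move: gtk; rewrite /girth_gt /girth Em => /leq_trans->.
Qed.

End Words.

(** * Torsion against large girth *)

Theorem lemma3p2 (G : groupType) (Gfg : finitely_generated G)
    (Ginf : infinite_girth G) :
  ~ (exists g : G, [/\ Gbound G g, torsion G g & g <> 1%g]).
Proof.
move=> [g [[M M0 ltM] [n n0 gn] g1]].
have [|S genS girthS] := Ginf (n * M)%N; first by rewrite muln_gt0 n0.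
have [w wS wmin] : exists2 w, represents_conjugate S g w &
    forall v, represents_conjugate S g v -> size w <= size v.
  have [w0 w0P] : exists w, represents_conjugate S g w.
    have [k /product_of_word[w [_ wS wg]]] := genS g.
    by exists w; split=> //; exists 1; rewrite conjg1.
  pose P k := exists2 w, represents_conjugate S g w & size w = k.
  have [|k [Ek [w wP sw] _]] := @least_le P (size w0); first by exists w0.
  exists w => // v vP.
  have [|l [El _ lev]] := @least_le P (size v); first by exists v.
  by move: El; rewrite Ek sw => -[->].
(* g is a conjugate of itself, so w is no longer than a shortest word for g. *)
have ltwM : size w < M.
  apply: leq_ltn_trans (ltM S genS).
  have [k /least_le[m [Em /product_of_word[v [sv vS vg]] _]]] := genS g.
  rewrite /word_length Em -sv; apply: wmin.
  by split=> //; exists 1; rewrite conjg1.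
have wred := minimal_cyclically_reduced wS wmin.
have [wl [h wg]] := wS.
have w0 : w != [::].
  apply/eqP=> w0; apply: g1; move: wg; rewrite w0 /word_value big_nil.
  by rewrite -[LHS](conj1g h) => /conjg_inj.
have size_wn : size (flatten (nseq n w)) = (n * size w)%N.
  by rewrite size_flatten /shape map_nseq sumn_nseq mulnC.
have [|||| p ploop] := @reduced_relation_loop G S (flatten (nseq n w)).
- exact: word_in_power.
- exact: sorted_flatten_nseq.
- by rewrite -size_eq0 size_wn muln_eq0 size_eq0 (negPf w0) orbF -lt0n.
- by rewrite word_value_power wg -conjXg gn conj1g.
rewrite size_wn leqNgt => /negP; apply.
apply: leq_ltn_trans (girth_gt_loop girthS ploop).
by rewrite leq_mul2l ltnW ?orbT.
Qed.
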